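(* The generating function $D(s,z)=\sum_{n\ge0}\sum_{P\in\mathcal D_n}s^{\mathrm{ds}(P)}z^n$ for Dyck paths with respect to their degree of symmetry is $D(s,z)=R(1,0,s,z)$, where $R(x,y):=R(x,y,s,z)$ (the generating function of quadrant walks defined in the context) satisfies the functional equation $$\left(xy-z(y+x^2)(1+y)\right)R(x,y)=xy-zy(1+y)R(0,y)+z\left(y^2-x^2+(s-1)y(x^2+1)\right)R(x,0)-zy(y+s-1)R(0,0).$$
   Context: $\mathcal D_n$ is the set of Dyck paths of semilength $n$: lattice paths from $(0,0)$ to $(2n,0)$ with steps $U=(1,1)$ and $D=(1,-1)$ that do not go below the $x$-axis. For $P\in\mathcal D_n$ with steps $\bar p_1,\dots,\bar p_{2n}$ from left to right viewed as segments in the plane, the degree of symmetry $\mathrm{ds}(P)$ is the number of $i\in\{1,\dots,n\}$ such that $\bar p_i$ and $\bar p_{2n+1-i}$ are mirror images under reflection along the vertical line $x=n$. $R(x,y,s,z)$ is the generating function in which the coefficient of $x^iy^js^kz^n$ is the number of walks in the first quadrant $\{(x,y):x,y\ge0\}$ with $n$ steps from the set $\{E,W,\mathrm{NW},\mathrm{SE}\}$, where $E=(1,0)$, $W=(-1,0)$, $\mathrm{NW}=(-1,1)$, $\mathrm{SE}=(1,-1)$, starting at the origin, ending at $(i,j)$, having exactly $k$ steps that lie entirely on the $x$-axis, and where each step $\mathrm{NW}$ leaving the $x$-axis (i.e. starting at a point with $y=0$) is given one of two possible colors. It is a formal power series in $z$ with coefficients polynomials in $x,y,s$. *)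

(* Defs.v *)
From HB Require Import structures.
From mathcomp Require Export all_boot all_order all_algebra.
From mathcomp Require Import boolp.
From mathcomp Require Export mpoly.

Set Implicit Arguments.
Unset Strict Implicit.
Unset Printing Implicit Defensive.

Import GRing.Theory Num.Theory.
Local Open Scope ring_scope.

(* The ring A[[z]] of formal power series; the product is the Cauchy product. *)

Record fps (A : Type) : Type := FPS { coefs : nat -> A }.

Notation "{ 'fps' A }" := (fps A) (format "{ 'fps'  A }") : type_scope.

HB.instance Definition _ (A : Type) := gen_eqMixin (fps A).
HB.instance Definition _ (A : Type) := gen_choiceMixin (fps A).

Lemma fpsP (A : Type) (f g : {fps A}) : coefs f =1 coefs g -> f = g.
Proof. by case: f => f; case: g => g /= /funext ->. Qed.

Section FpsZmodule.
Variable A : zmodType.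
Implicit Types f g h : {fps A}.

Definition fps_zero : {fps A} := FPS (fun _ => 0).
Definition fps_opp f : {fps A} := FPS (fun n => - coefs f n).
Definition fps_add f g : {fps A} := FPS (fun n => coefs f n + coefs g n).

Fact fps_addA : associative fps_add.
Proof. by move=> f g h; apply: fpsP => n /=; rewrite addrA. Qed.

Fact fps_addC : commutative fps_add.
Proof. by move=> f g; apply: fpsP => n /=; rewrite addrC. Qed.

Fact fps_add0 : left_id fps_zero fps_add.
Proof. by move=> f; apply: fpsP => n /=; rewrite add0r. Qed.

Fact fps_addN : left_inverse fps_zero fps_opp fps_add.
Proof. by move=> f; apply: fpsP => n /=; rewrite addNr. Qed.

HB.instance Definition _ := GRing.isZmodule.Build {fps A}
  fps_addA fps_addC fps_add0 fps_addN.

End FpsZmodule.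

Section FpsRing.
Variable A : comNzRingType.
Implicit Types (f g h : {fps A}) (a : A).

Definition fpsC a : {fps A} := FPS (fun n => if n == 0%N then a else 0).
Definition fpsX : {fps A} := FPS (fun n => (n == 1%N)%:R).
Definition fps_mul f g : {fps A} :=
  FPS (fun n => \sum_(i < n.+1) coefs f i * coefs g (n - i)%N).

Let tr N f : {poly A} := \poly_(i < N.+1) coefs f i.

Fact fps_mul_trunc f g N n :
  (n <= N)%N -> coefs (fps_mul f g) n = (tr N f * tr N g)`_n.
Proof.
move=> le_nN; rewrite coefM /tr; apply: eq_bigr => -[i /= lt_in] _.
rewrite !coef_poly !ltnS (leq_trans _ le_nN) //.
by rewrite (leq_trans (leq_subr _ _) le_nN).
Qed.

Fact fps_mulA : associative fps_mul.
Proof.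
move=> f g h; apply: fpsP => n.
transitivity ((tr n f * (tr n g * tr n h))`_n).
  rewrite coefM; apply: eq_bigr => -[i /= lt_in] _.
  by rewrite coef_poly lt_in -fps_mul_trunc ?leq_subr.
rewrite mulrA coefM; apply: eq_bigr => -[i /= lt_in] _.
by rewrite -fps_mul_trunc // /tr coef_poly ltnS leq_subr.
Qed.

Fact fps_mulC : commutative fps_mul.
Proof.
move=> f g; apply: fpsP => n.
by rewrite !(@fps_mul_trunc _ _ n) // mulrC.
Qed.

Fact fps_mul1 : left_id (fpsC 1) fps_mul.
Proof.
move=> f; apply: fpsP => n /=; rewrite big_ord_recl /= mul1r subn0.
by rewrite big1 ?addr0 // => i _; rewrite mul0r.
Qed.

Fact fps_mulDl : left_distributive fps_mul (@fps_add A).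
Proof.
move=> f g h; apply: fpsP => n /=; rewrite -big_split /=.
by apply: eq_bigr => i _; rewrite mulrDl.
Qed.

Fact fps_oner_neq0 : fpsC 1 != 0.
Proof.
apply/eqP => /(congr1 (fun f => coefs f 0%N)) /= /eqP.
by rewrite oner_eq0.
Qed.

HB.instance Definition _ := GRing.Zmodule_isComNzRing.Build {fps A}
  fps_mulA fps_mulC fps_mul1 fps_mulDl fps_oner_neq0.

End FpsRing.

Arguments fpsX {A}.

(* The coefficient ring Z[x,y,s], with x, y, s the variables 0, 1, 2. *)


Definition varx : {mpoly int[3]} := 'X_(@Ordinal 3 0 isT).
Definition vary : {mpoly int[3]} := 'X_(@Ordinal 3 1 isT).
Definition vars : {mpoly int[3]} := 'X_(@Ordinal 3 2 isT).

(* Lattice paths starting at the origin, given by their sequences of steps. *)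

Definition vertex (S : Type) (vec : S -> int * int) (w : seq S) (i : nat) :
  int * int := \sum_(a <- take i w) vec a.

(* Dyck paths: true is the up step U and false is the down step D. *)

Definition dyck_vec (u : bool) : int * int := if u then (1, 1) else (1, -1).

Definition is_dyck (n : nat) (P : n.*2.-tuple bool) : bool :=
  [forall i : 'I_(n.*2.+1), 0 <= (vertex dyck_vec P i).2]
  && (vertex dyck_vec P n.*2 == (n.*2%:Z, 0)).

(* Segments are given by their left and right endpoints; reflecting along a
   vertical line exchanges the two. Steps are numbered from 0. *)

Definition dyck_segment (P : seq bool) (i : nat) : (int * int) * (int * int) :=
  (vertex dyck_vec P i, vertex dyck_vec P i.+1).

Definition reflect_point (n : nat) (p : int * int) : int * int :=
  (n.*2%:Z - p.1, p.2).

Definition reflect_segment (n : nat) (e : (int * int) * (int * int)) :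
  (int * int) * (int * int) := (reflect_point n e.2, reflect_point n e.1).

Definition degree_of_symmetry (n : nat) (P : n.*2.-tuple bool) : nat :=
  #|[set i : 'I_n | dyck_segment P i
       == reflect_segment n (dyck_segment P (n.*2 - i.+1))]|.

Definition dyck_gf : {fps {mpoly int[3]}} :=
  FPS (fun n => \sum_(P : n.*2.-tuple bool | is_dyck P)
                  vars ^+ degree_of_symmetry P).

Inductive qstep : Type := East | West | NorthWest | SouthEast.

Definition qstep_code (a : qstep) : bool * bool :=
  match a with
  | East => (false, false) | West => (false, true)
  | NorthWest => (true, false) | SouthEast => (true, true)
  end.

Definition qstep_decode (c : bool * bool) : qstep :=
  match c with
  | (false, false) => East | (false, true) => West
  | (true, false) => NorthWest | (true, true) => SouthEast
  end.

Fact qstep_codeK : cancel qstep_code qstep_decode.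
Proof. by case. Qed.

HB.instance Definition _ := Countable.copy qstep (can_type qstep_codeK).
HB.instance Definition _ : isFinite qstep := CanIsFinite qstep_codeK.

Definition qstep_vec (a : qstep) : int * int :=
  match a with
  | East => (1, 0) | West => (-1, 0)
  | NorthWest => (-1, 1) | SouthEast => (1, -1)
  end.

(* A step of a coloured walk is a step together with a colour; the colour true
   is only available to the steps NW that start on the x-axis, so that these
   have two colours and all other steps have one. *)

Notation cstep := (qstep * bool)%type.

Definition walk_vertex (w : seq cstep) (i : nat) : int * int :=
  vertex (fun a : cstep => qstep_vec a.1) w i.

Definition quadrant_walk (n : nat) (w : n.-tuple cstep) : bool :=
  [forall i : 'I_n.+1, (0 <= (walk_vertex w i).1) && (0 <= (walk_vertex w i).2)]
  && [forall i : 'I_n, (tnth w i).2 ==>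
        ((tnth w i).1 == NorthWest) && ((walk_vertex w i).2 == 0)].

Definition axis_steps (n : nat) (w : n.-tuple cstep) : nat :=
  #|[set i : 'I_n | ((walk_vertex w i).2 == 0)
                    && ((walk_vertex w i.+1).2 == 0)]|.

Definition walk_gf : {fps {mpoly int[3]}} :=
  FPS (fun n => \sum_(w : n.-tuple cstep | quadrant_walk w)
                  varx ^+ `|(walk_vertex w n).1|%N
                  * vary ^+ `|(walk_vertex w n).2|%N
                  * vars ^+ axis_steps w).

(* R(a,b): substitution of a for x and b for y, coefficient by coefficient. *)
Definition walk_gf_at (a b : {mpoly int[3]}) : {fps {mpoly int[3]}} :=
  FPS (fun n => coefs walk_gf n \mPo [tuple a; b; vars]).

Lemma walk_gf_at_xy : walk_gf_at varx vary = walk_gf.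
Proof.
apply: fpsP => n /=; set p := (X in X \mPo _).
rewrite -[RHS]comp_mpoly_id; congr (_ \mPo _).
by apply: eq_from_tnth; case=> -[|[|[|//]]] ? //; rewrite tnth_mktuple;
  congr ('X__); apply: val_inj.
Qed.

Fact monomial_xys (i j k : nat) :
  varx ^+ i * vary ^+ j * vars ^+ k
  = 'X_[[multinom nth 0%N [:: i; j; k] t | t < 3]].
Proof.
rewrite mpolyXE_id !big_ord_recl big_ord0 mulr1 !mnmE /= -mulrA.
by congr (_ * (_ * _)); congr ('X__ ^+ _); apply: val_inj.
Qed.

Lemma coef_walk_gf (n i j k : nat) :
  (coefs walk_gf n)@_[multinom nth 0%N [:: i; j; k] t | t < 3]
  = #|[set w : n.-tuple cstep |
        [&& quadrant_walk w, walk_vertex w n == (i%:Z, j%:Z)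
          & axis_steps w == k]]|%:R.
Proof.
rewrite /= raddf_sum -sum1_card natr_sum big_mkcond [in RHS]big_mkcond /=.
apply: eq_bigr => w _; rewrite inE.
case wP: (quadrant_walk w) => //=; rewrite monomial_xys mcoeffX.
have /andP[x0 y0] : (0 <= (walk_vertex w n).1) && (0 <= (walk_vertex w n).2).
  by case/andP: wP => /forallP/(_ ord_max).
case: (walk_vertex w n) x0 y0 => -[] // a [] // b _ _ /=.
rewrite (_ : (_ == _) = (((a%:Z, b%:Z) == (i%:Z, j%:Z)) && (axis_steps w == k))).
  by case: ifP.
apply/eqP/andP => [E | [/eqP[-> ->] /eqP ->] //].
have E0 (t : 'I_3) := congr1 (fun m : 'X_{1.. 3} => m t) E.
have := E0 (@Ordinal 3 0 isT); have := E0 (@Ordinal 3 1 isT).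
have := E0 (@Ordinal 3 2 isT).
by rewrite !mnmE /= => -> -> ->; split.
Qed.

(* Main.v *)
(* Read a Dyck path of semilength n simultaneously from its left end and, mirrored,
   from its right end. The heights (h, h') of the two halves form a walk in the
   quadrant with diagonal steps that ends on the diagonal h = h', and the symmetric
   steps are those with both ends on the diagonal. Folding along the diagonal by
   (h, h') |-> (min h h', |h - h'| / 2) turns it into a walk with steps E, W, NW, SE
   ending on the x-axis; the two colours of NW record which half goes above the
   other when leaving the diagonal. The functional equation comes from removing the
   last step of a walk. *)

From HB Require Import structures.
Require Import Defs.
From mathcomp Require Import ring zify.

Set Implicit Arguments.
Unset Strict Implicit.
Unset Printing Implicit Defensive.

Import GRing.Theory Num.Theory.
Local Open Scope ring_scope.

(** * Weighted sums over walks as iterates of a transfer operator *)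

Section Transfer.
Variables (A : comNzRingType) (S : finType) (vec : S -> int * int).
Variable c : int * int -> S -> A.
Implicit Types (f g : int * int -> A) (p : int * int).

Definition transfer f p : A := \sum_a c p a * f (p + vec a).

Lemma big_tuple_cons n (F : n.+1.-tuple S -> A) :
  \sum_w F w = \sum_a \sum_(w : n.-tuple S) F [tuple of a :: w].
Proof.
rewrite pair_big /=
  (reindex (fun aw : S * n.-tuple S => [tuple of aw.1 :: aw.2])) //=.
exists (fun w => (thead w, [tuple of behead w])) => [[a w] _|w _] /=.
  by rewrite theadE; congr (_, _); apply: val_inj.
by rewrite -tuple_eta.
Qed.

Lemma vertex0 (w : seq S) : vertex vec w 0 = 0.
Proof. by rewrite /vertex take0 big_nil. Qed.

Lemma vertex_consS a (w : seq S) i :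
  vertex vec (a :: w) i.+1 = vec a + vertex vec w i.
Proof. by rewrite /vertex /= big_cons. Qed.

Lemma vertexS n (w : n.-tuple S) (i : 'I_n) :
  vertex vec w i.+1 = vertex vec w i + vec (tnth w i).
Proof.
rewrite /vertex (tnth_nth (tnth w i)) (take_nth (tnth w i)) ?size_tuple //.
by rewrite -cats1 big_cat big_seq1.
Qed.

(** Induction peels off the first step, which is the outermost application of the operator. The
    innermost application is the last step, so both ends of a walk are accessible. *)
Lemma sum_transfer n f p :
  \sum_(w : n.-tuple S)
     (\prod_(i < n) c (p + vertex vec w i) (tnth w i)) * f (p + vertex vec w n)
  = iter n transfer f p.
Proof.
elim: n p => [|n IHn] p.
  rewrite (big_pred1 [tuple]) => [|w]; last exact/esym/eqP/tuple0.
  by rewrite big_ord0 mul1r vertex0 addr0.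
rewrite big_tuple_cons iterS; apply: eq_bigr => a _; rewrite -IHn big_distrr /=.
apply: eq_bigr => w _; rewrite big_ord_recl vertex_consS vertex0 addr0 -mulrA addrA.
congr (_ * (_ * _)); apply: eq_bigr => i _.
by rewrite vertex_consS tnthS addrA.
Qed.

End Transfer.

Definition in_quadrant (p : int * int) : bool := (0 <= p.1) && (0 <= p.2).

(** One product handles both a constraint and a statistic: a forbidden step contributes a zero
    factor, and each marked step a factor [s]. *)
Lemma prod_guarded (A : comNzRingType) n (b m : pred 'I_n) (s : A) :
  \prod_(i < n) (if b i then s ^+ m i else 0)
  = if [forall i, b i] then s ^+ #|[set i | m i]| else 0.
Proof.
case: ifPn => [/forallP bT|/forallPn[i /negbTE bi]].
  rewrite (eq_bigr (fun i => s ^+ m i)) => [|i _]; last by rewrite bT.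
  rewrite prodrXr; congr (_ ^+ _); rewrite cardsE -sum1_card [RHS]big_mkcond /=.
  by apply: eq_bigr => i _; rewrite unfold_in; case: (m i).
by rewrite (bigD1 i) //= bi mul0r.
Qed.

(** The origin lies in the quadrant, so checking the endpoint of each step suffices. This makes the
    constraint local to steps, as [prod_guarded] requires. *)
Lemma forall_vertex (S : finType) (vec : S -> int * int) n (w : n.-tuple S) :
  [forall i : 'I_n.+1, in_quadrant (vertex vec w i)]
  = [forall i : 'I_n, in_quadrant (vertex vec w i + vec (tnth w i))].
Proof.
apply/forallP/forallP => wP i.
  by rewrite -vertexS; have := wP (lift ord0 i); rewrite lift0.
case: (unliftP ord0 i) => [j|] ->; last by rewrite /= vertex0.
by rewrite lift0 vertexS.
Qed.

Lemma andb_forall (n : nat) (P Q : pred 'I_n) :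
  [forall i, P i] && [forall i, Q i] = [forall i, P i && Q i].
Proof.
apply/andP/forallP => [[/forallP pP /forallP qP] i|pqP]; first by rewrite pP qP.
by split; apply/forallP => i; case/andP: (pqP i).
Qed.

(** * Coloured quadrant walks *)

Notation poly3 := {mpoly int[3]}.

Definition on_axis (p : int * int) : bool := p.2 == 0.

Definition cvec (a : cstep) : int * int := qstep_vec a.1.

Definition walk_weight (p : int * int) (a : cstep) : poly3 :=
  if in_quadrant (p + cvec a) && (a.2 ==> (a.1 == NorthWest) && on_axis p)
  then vars ^+ (on_axis p && on_axis (p + cvec a)%R) else 0.

Definition walk_sum n (f : int * int -> poly3) : poly3 :=
  \sum_(w : n.-tuple cstep | quadrant_walk w)
     f (walk_vertex w n) * vars ^+ axis_steps w.

Lemma walk_sum_iter n f : walk_sum n f = iter n (transfer cvec walk_weight) f 0.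
Proof.
rewrite -sum_transfer /walk_sum big_mkcond /=; apply: eq_bigr => w _.
rewrite /walk_weight; under eq_bigr => i _ do rewrite !add0r -vertexS.
rewrite prod_guarded /quadrant_walk add0r.
under [in RHS]eq_forallb => i do rewrite vertexS.
rewrite -andb_forall -forall_vertex.
by rewrite /axis_steps mulrC; case: ifP => //; rewrite mul0r.
Qed.

(** Removal of the last step, whose contribution is absorbed into the function of the endpoint. *)
Lemma walk_sumS n f : walk_sum n.+1 f = walk_sum n (transfer cvec walk_weight f).
Proof. by rewrite !walk_sum_iter iterSr. Qed.

Lemma eq_walk_sum n f g : (forall i j : nat, f (i%:Z, j%:Z) = g (i%:Z, j%:Z)) ->
  walk_sum n f = walk_sum n g.
Proof.
move=> fg; apply: eq_bigr => w /andP[/forallP/(_ ord_max) /=].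
by case: (walk_vertex w n) => -[] // i [] // j _ _; rewrite fg.
Qed.

Lemma coefs_walk_gf_at a b n :
  coefs (walk_gf_at a b) n
  = walk_sum n (fun p => a ^+ `|p.1|%N * b ^+ `|p.2|%N).
Proof.
rewrite /= raddf_sum; apply: eq_bigr => w _.
by rewrite /= !rmorphM !rmorphXn /= !comp_mpolyXU.
Qed.

Lemma big_cstep (F : cstep -> poly3) :
  \sum_a F a = \sum_(b : bool) (F (East, b) + F (West, b) + F (NorthWest, b)
    + F (SouthEast, b)).
Proof.
rewrite (reindex (fun p : bool * (bool * bool) => (qstep_decode p.2, p.1))) /=.
  rewrite -(pair_bigA _ (fun b cd => F (qstep_decode cd, b))) /=.
  apply: eq_bigr => b _; rewrite (eq_bigr (fun p => F (qstep_decode (p.1, p.2), b))).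
    by rewrite -(pair_bigA _ (fun c d => F (qstep_decode (c, d), b))) /=
      !big_bool /=; ring.
  by case.
by exists (fun a : cstep => (a.2, qstep_code a.1)) => [[? [[] []]]|[[] ?]].
Qed.

Lemma Posz_add1 (n : nat) : n%:Z + 1 = n.+1%:Z. Proof. by lia. Qed.
Lemma Posz_sub1 (n : nat) : n.+1%:Z - 1 = n%:Z. Proof. by lia. Qed.
Lemma pair_add (a b c d : int) : (a, b) + (c, d) = (a + c, b + d).
Proof. by []. Qed.

(** The terms are E, W, NW and SE. The multiplicity [(j == 0).+1] counts the colours of NW, and the
    zero branches are the steps that would leave the quadrant. *)
Lemma transfer_walk f (i j : nat) :
  transfer cvec walk_weight f (i%:Z, j%:Z)
  = vars ^+ (j == 0)%N * f (i.+1%:Z, j%:Z)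
    + (if i is i'.+1 then vars ^+ (j == 0)%N * f (i'%:Z, j%:Z)
                          + (f (i'%:Z, j.+1%:Z) *+ (j == 0).+1) else 0)
    + (if j is j'.+1 then f (i.+1%:Z, j'%:Z) else 0).
Proof.
rewrite /transfer big_cstep big_bool /walk_weight /cvec /in_quadrant /on_axis /=.
by case: i j => [|i] [|j]; rewrite !pair_add !addr0 ?Posz_add1 ?Posz_sub1 ?sub0r /=;
  ring.
Qed.

(** * Pairs of heights and folding along the diagonal *)

Definition pvec (a : bool * bool) : int * int :=
  (if a.1 then 1 else -1, if a.2 then 1 else -1).

Definition on_diagonal (p : int * int) : bool := p.1 == p.2.

Definition pair_weight (p : int * int) (a : bool * bool) : poly3 :=
  if in_quadrant (p + pvec a)
  then vars ^+ (on_diagonal p && on_diagonal (p + pvec a)%R) else 0.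

Lemma transfer_pair f (i j : nat) :
  transfer pvec pair_weight f (i%:Z, j%:Z)
  = vars ^+ (i == j)%N * f (i.+1%:Z, j.+1%:Z)
    + (if j is j'.+1 then f (i.+1%:Z, j'%:Z) else 0)
    + (if i is i'.+1 then f (i'%:Z, j.+1%:Z) else 0)
    + (if i is i'.+1 then if j is j'.+1 then vars ^+ (i == j)%N * f (i'%:Z, j'%:Z)
       else 0 else 0).
Proof.
rewrite /transfer.
rewrite (eq_bigr (fun a => pair_weight (i%:Z, j%:Z) (a.1, a.2)
  * f ((i%:Z, j%:Z) + pvec (a.1, a.2)))) => [|[a b] _ //].
rewrite -(pair_bigA _ (fun a b => pair_weight (i%:Z, j%:Z) (a, b)
  * f ((i%:Z, j%:Z) + pvec (a, b)))) /= !big_bool.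
rewrite /pair_weight /pvec /in_quadrant /on_diagonal /=.
(* An antidiagonal step changes the difference of the heights by two, so it never has both ends on
   the diagonal and carries no [vars]. *)
have lt2 k l : (k.+1 == l.+1 :> int) && (k.+2 == l :> int) = false by lia.
have gt2 k l : (k.+1 == l.+1 :> int) && (k == l.+2 :> int) = false by lia.
by case: i j => [|i] [|j];
  rewrite !pair_add ?Posz_add1 ?Posz_sub1 ?sub0r /= ?lt2 ?gt2
    ?eqz_nat ?eqSS ?andbb /=;
  ring.
Qed.

(* [(i, i + 2j)] and its mirror image are the two preimages of [(i, j)] under the
   folding map; they coincide when [j = 0]. *)
Definition folds_to (g f : int * int -> poly3) : Prop :=
  forall i j : nat, g (i%:Z, (i + j.*2)%N%:Z) = f (i%:Z, j%:Z)
                 /\ g ((i + j.*2)%N%:Z, i%:Z) = f (i%:Z, j%:Z).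

(** Moving both heights up or down folds to E or W; widening or narrowing the gap folds to NW or SE.
    On the diagonal both antidiagonal steps widen the gap, which matches the two colours of NW. *)
Lemma folds_to_transfer g f : folds_to g f ->
  folds_to (transfer pvec pair_weight g) (transfer cvec walk_weight f).
Proof.
move=> gf i j; rewrite !transfer_pair transfer_walk.
(* The folded positions after E, W, SE and NW. A predecessor truncated at zero is harmless, since
   that step is then absent from the sums. *)
have E1 := gf i.+1 j; have E2 := gf i.-1 j; have E3 := gf i.+1 j.-1.
have E4 := gf i.-1 j.+1.
have ne k l : (k.+1 == (k + l).+3)%N = false by lia.
have ne' k l : ((k + l).+3 == k.+1)%N = false by lia.
case: i j E1 E2 E3 E4 => [|i] [|j] /=;
  rewrite ?doubleS ?double0 ?addnS ?addSn ?addn0 ?add0n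
  ?eqxx ?ne ?ne' => -[E1 E1'] [E2 E2'] [E3 E3'] [E4 E4'];
  rewrite ?E1 ?E1' ?E2 ?E2' ?E3 ?E3' ?E4 ?E4' /=; split; ring.
Qed.

Lemma folds_to_iter n g f : folds_to g f ->
  folds_to (iter n (transfer pvec pair_weight) g)
           (iter n (transfer cvec walk_weight) f).
Proof. by move=> gf; elim: n => //= n; apply: folds_to_transfer. Qed.

(** * Unfolding pairs of half-paths into Dyck paths *)

(* The right half is traversed backwards, so up steps become down steps. *)
Definition unfold_seq (w : seq (bool * bool)) : seq bool :=
  [seq a.1 | a <- w] ++ rev [seq ~~ a.2 | a <- w].

Lemma size_unfold n (w : n.-tuple (bool * bool)) : size (unfold_seq w) == n.*2.
Proof. by rewrite size_cat size_rev !size_map size_tuple addnn. Qed.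

Definition unfold_tuple n (w : n.-tuple (bool * bool)) : n.*2.-tuple bool :=
  Tuple (size_unfold w).

Lemma unfold_tuple_bij n : bijective (@unfold_tuple n).
Proof.
apply: inj_card_bij => [w1 w2|]; last first.
  by rewrite !card_tuple card_prod card_bool -mul2n expnM.
move=> /(congr1 val) /= /eqP.
rewrite eqseq_cat ?size_map ?size_tuple // (inj_eq (can_inj revK)).
case/andP=> /eqP E1 /eqP E2; apply: val_inj => /=.
elim: (val w1) (val w2) E1 E2 => [|[a b] s IHs] [|[a' b'] s'] //=.
by move=> [-> E1] [/negb_inj -> E2]; rewrite (IHs s').
Qed.

Lemma sum_dyck_fst (w : seq (bool * bool)) :
  \sum_(a <- [seq a.1 | a <- w]) dyck_vec a
  = ((size w)%:Z, (\sum_(a <- w) pvec a).1).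
Proof.
elim: w => [|[a b] w IHw]; first by rewrite !big_nil.
by rewrite /= !big_cons IHw; case: a; congr (_, _); rewrite /= -add1n PoszD.
Qed.

Lemma sum_dyck_snd (w : seq (bool * bool)) :
  \sum_(a <- rev [seq ~~ a.2 | a <- w]) dyck_vec a
  = ((size w)%:Z, - (\sum_(a <- w) pvec a).2).
Proof.
elim: w => [|[a b] w IHw]; first by rewrite !big_nil.
rewrite /= rev_cons -cats1 big_cat big_seq1 IHw big_cons.
by case: b; congr (_, _); rewrite /= ?opprD addrC // -add1n PoszD.
Qed.

Section Unfold.
Variables (n : nat) (w : n.-tuple (bool * bool)).

Lemma vertex_unfold_left i : (i <= n)%N ->
  vertex dyck_vec (unfold_tuple w) i = (i%:Z, (vertex pvec w i).1).
Proof.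
move=> le_in; rewrite /vertex /= /unfold_seq takel_cat ?size_map ?size_tuple //.
by rewrite -map_take sum_dyck_fst size_takel ?size_tuple.
Qed.

(** The offset in the height is the final height of the whole path, which vanishes exactly when the
    two halves meet on the diagonal. *)
Lemma vertex_unfold_right k : (k <= n)%N ->
  vertex dyck_vec (unfold_tuple w) (n.*2 - k)
  = (n.*2%:Z - k%:Z,
     (vertex pvec w n).1 - (vertex pvec w n).2 + (vertex pvec w k).2).
Proof.
move=> le_kn; rewrite /vertex /= /unfold_seq.
rewrite take_cat !size_map size_tuple ltnNge (_ : n <= _)%N /=; last by lia.
rewrite take_rev !size_map size_tuple (_ : n - _ = k)%N; last by lia.
rewrite big_cat /= sum_dyck_fst -map_drop sum_dyck_snd size_drop !size_tuple.
have E : \sum_(a <- w) pvec a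
    = \sum_(a <- take k w) pvec a + \sum_(a <- drop k w) pvec a.
  by rewrite -big_cat cat_take_drop.
rewrite pair_add take_oversize ?size_tuple // E /=.
congr (_, _); first by lia.
ring.
Qed.

Lemma is_dyck_unfold : is_dyck (unfold_tuple w)
  = [forall i : 'I_n.+1, in_quadrant (vertex pvec w i)]
    && on_diagonal (vertex pvec w n).
Proof.
rewrite /is_dyck; have := vertex_unfold_right (leq0n n).
rewrite subn0 vertex0 /= addr0 subr0 => ->.
rewrite xpair_eqE eqxx /= subr_eq0.
case: (boolP (_ == _)) => E; last
  by rewrite !andbF /on_diagonal (negbTE E) andbF.
rewrite /on_diagonal E !andbT.
apply/forallP/forallP => posP i.
  have le_in : (i <= n)%N by rewrite -ltnS.
  (* Vertices [i] and [n.*2 - i] of the path carry the two coordinates of the [i]-th pair of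
     heights. *)
  have := posP (inord i); have := posP (inord (n.*2 - i)).
  rewrite !inordK; try lia.
  rewrite vertex_unfold_right // vertex_unfold_left //= (eqP E) subrr add0r.
  by rewrite /in_quadrant => -> ->.
case: (leqP i n) => [le_in|lt_ni].
  have := posP (inord i); rewrite inordK // => /andP[p1 _].
  by rewrite vertex_unfold_left.
have le_kn : (n.*2 - i <= n)%N by lia.
have := posP (inord (n.*2 - i)); rewrite inordK ?ltnS // => /andP[_ p2].
have -> : nat_of_ord i = (n.*2 - (n.*2 - i))%N by have := ltn_ord i; lia.
by rewrite vertex_unfold_right //= (eqP E) subrr add0r.
Qed.

(** The mirror partner of step [i] runs between vertices [n.*2 - i.+1] and [n.*2 - i]. Abscissae
    agree after reflection automatically, so symmetry means equal heights at both ends. *)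
Lemma degree_of_symmetry_unfold : on_diagonal (vertex pvec w n) ->
  degree_of_symmetry (unfold_tuple w)
  = #|[set i : 'I_n | on_diagonal (vertex pvec w i)
                      && on_diagonal (vertex pvec w i.+1)]|.
Proof.
move=> /eqP E; congr #|pred_of_set _|; apply/setP => i; rewrite !inE.
rewrite /dyck_segment /reflect_segment /=.
have lt_in := ltn_ord i.
have -> : (n.*2 - i.+1).+1 = (n.*2 - i)%N by lia.
rewrite !vertex_unfold_right ?(ltnW lt_in) // !vertex_unfold_left ?(ltnW lt_in) //.
rewrite /reflect_point /= E subrr !add0r !subKr.
by rewrite !xpair_eqE !eqxx.
Qed.

End Unfold.

(** The requirement that the halves meet becomes the indicator of the diagonal, evaluated at the
    endpoint. *)
Lemma coefs_dyck_gf n :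
  coefs dyck_gf n
  = iter n (transfer pvec pair_weight) (fun p => (on_diagonal p)%:R) 0.
Proof.
rewrite /= (reindex (@unfold_tuple n)) /=; last first.
  exact: onW_bij (unfold_tuple_bij n).
rewrite -sum_transfer big_mkcond; apply: eq_bigr => w _.
rewrite /pair_weight; under eq_bigr => i _ do rewrite !add0r -vertexS.
rewrite prod_guarded add0r is_dyck_unfold forall_vertex.
under [in RHS]eq_forallb => i do rewrite vertexS.
case: (boolP (on_diagonal (vertex pvec w n))) => [E|_]; last by rewrite andbF mulr0.
by rewrite degree_of_symmetry_unfold // andbT mulr1.
Qed.

(** * Coefficient extraction and the functional equation *)

Lemma coefs_fpsCM (A : comNzRingType) (a : A) (f : {fps A}) n :
  coefs (fpsC a * f) n = a * coefs f n.
Proof.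
by rewrite /= big_ord_recl subn0 big1 ?addr0 // => i _; rewrite mul0r.
Qed.

Lemma coefs_fpsD (A : comNzRingType) (f g : {fps A}) n :
  coefs (f + g) n = coefs f n + coefs g n.
Proof. by []. Qed.

Lemma coefs_fpsXM (A : comNzRingType) (f : {fps A}) n :
  coefs (fpsX * f) n = if n is n'.+1 then coefs f n' else 0.
Proof.
case: n => [|n] /=; first by rewrite big_ord_recl big_ord0 /= mul0r addr0.
rewrite !big_ord_recl /= mul0r add0r mul1r big1 ?addr0 ?subSS ?subn0 // => i _.
by rewrite mul0r.
Qed.

Fact fpsC_is_zmod_morphism (A : comNzRingType) : zmod_morphism (@fpsC A).
Proof. by move=> a b; apply: fpsP => -[|n] //=; rewrite subr0. Qed.

Fact fpsC_is_monoid_morphism (A : comNzRingType) : monoid_morphism (@fpsC A).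
Proof.
split=> // a b; apply: fpsP => n; rewrite coefs_fpsCM /=.
by case: ifP; rewrite ?mulr0.
Qed.

HB.instance Definition _ (A : comNzRingType) :=
  GRing.isZmodMorphism.Build A {fps A} (@fpsC A) (@fpsC_is_zmod_morphism A).
HB.instance Definition _ (A : comNzRingType) :=
  GRing.isMonoidMorphism.Build A {fps A} (@fpsC A) (@fpsC_is_monoid_morphism A).

Lemma walk_sumD n f g : walk_sum n (fun p => f p + g p)
  = walk_sum n f + walk_sum n g.
Proof. by rewrite -big_split; apply: eq_bigr => w _; rewrite mulrDl. Qed.

Lemma walk_sumZ n a f : walk_sum n (fun p => a * f p) = a * walk_sum n f.
Proof. by rewrite big_distrr; apply: eq_bigr => w _; rewrite /= mulrA. Qed.

(* The powers of 0 are the indicators of [i = 0] and [j = 0], since [0 ^+ 0 = 1]. *)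
Lemma transfer_monomial (x y : poly3) (i j : nat) :
  x * y * transfer cvec walk_weight (fun p => x ^+ `|p.1|%N * y ^+ `|p.2|%N)
    (i%:Z, j%:Z)
  = (y + x ^+ 2) * (1 + y) * (x ^+ i * y ^+ j)
    + - (y * (1 + y)) * (0 ^+ i * y ^+ j)
    + (y ^+ 2 - x ^+ 2 + (vars - 1) * y * (x ^+ 2 + 1)) * (x ^+ i * 0 ^+ j)
    + - (y * (y + vars - 1)) * (0 ^+ i * 0 ^+ j).
Proof.
rewrite transfer_walk; case: i j => [|i] [|j] /=;
  rewrite ?expr0n ?expr0 /= ?exprS; ring.
Qed.

Theorem theorem6p1 :
  let x := fpsC varx in
  let y := fpsC vary in
  let s := fpsC vars in
  let z := fpsX in
  let R := walk_gf_at in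
  dyck_gf = R 1 0
  /\ (x * y - z * (y + x ^+ 2) * (1 + y)) * R varx vary
     = x * y
       - z * y * (1 + y) * R 0 vary
       + z * (y ^+ 2 - x ^+ 2 + (s - 1) * y * (x ^+ 2 + 1)) * R varx 0
       - z * y * (y + s - 1) * R 0 0.
Proof.
move=> x y s z R; split.
  apply: fpsP => n; rewrite coefs_dyck_gf coefs_walk_gf_at walk_sum_iter.
  (* At x = 1, y = 0 the endpoint monomial is the indicator of the x-axis, to which the diagonal
     folds. *)
  have E : folds_to (fun p => (on_diagonal p)%:R)
      (fun p => 1 ^+ `|p.1|%N * 0 ^+ `|p.2|%N).
    move=> i [|j]; rewrite /on_diagonal /= expr1n mul1r expr0n /=.
      by rewrite addn0 eqxx.
    by split; congr (_%:R); lia.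
  by case: (folds_to_iter n E 0%N 0%N).
pose P := (vary + varx ^+ 2) * (1 + vary).
pose Q0 := - (vary * (1 + vary)).
pose Q1 := vary ^+ 2 - varx ^+ 2 + (vars - 1) * vary * (varx ^+ 2 + 1).
pose Q2 := - (vary * (vary + vars - 1)).
(* Fixed-point form of the equation, with the coefficients of [transfer_monomial]. The factor xy
   clears the negative exponents produced by W, NW and SE. *)
suff E : fpsC (varx * vary) * R varx vary
  = fpsC (varx * vary) + z * (fpsC P * R varx vary + fpsC Q0 * R 0 vary
     + fpsC Q1 * R varx 0 + fpsC Q2 * R 0 0).
  rewrite mulrBl -rmorphM E /P /Q0 /Q1 /Q2.
  rewrite !(rmorphM, rmorphD, rmorphN, rmorphB, rmorphXn, rmorph1) /=.
  rewrite -/x -/y -/s; ring.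
(* The constant coefficient is the empty walk; every other coefficient follows by removing the last
   step. *)
apply: fpsP => -[|n]; rewrite coefs_fpsCM coefs_fpsD coefs_fpsXM coefs_walk_gf_at.
  by rewrite walk_sum_iter /= !expr0 !mulr1 addr0.
rewrite [coefs (fpsC _) _]/= add0r walk_sumS -walk_sumZ.
rewrite !coefs_fpsD !coefs_fpsCM !coefs_walk_gf_at -!walk_sumZ -!walk_sumD.
by apply: eq_walk_sum => i j; rewrite transfer_monomial.
Qed.
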